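(* Let $T\ge1$, $G>0$, and let $f_1,\dots,f_T:\mathbb{R}^d\to\mathbb{R}$ be convex and $G$-Lipschitz. Let $f=\frac1T\sum_{t=1}^Tf_t$ and assume $f$ has a minimizer $x_*\in\arg\min f$. Then the output $x_K$ of the Incremental Proximal Method with step sizes $\eta_1,\dots,\eta_K>0$, started at $x_0$, satisfies $$f(x_K)-f(x_* )\le\frac{1}{2T\sum_{k=1}^K\eta_k}\|x_0-x_*\|^2+\frac{G^2T}{2}\sum_{k=1}^K\frac{\eta_k^2}{\sum_{j=k}^K\eta_j}.$$ Moreover, given $\epsilon>0$, there exists a constant step size $\eta$ such that $f(x_K)-f(x_* )\le\epsilon$ after $TK=\widetilde{\mathcal{O}}\Big(\frac{G^2T\|x_0-x_*\|^2}{\epsilon^2}\Big)$ individual proximal oracle queries.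
   Context: $\|\cdot\|$ is the Euclidean norm on $\mathbb{R}^d$. $g$ is $G$-Lipschitz if $|g(x)-g(y)|\le G\|x-y\|$ for all $x,y$. For convex $g$ and $\eta>0$, $\mathrm{prox}_{\eta g}(x)=\arg\min_{y\in\mathbb{R}^d}\{\frac{1}{2\eta}\|y-x\|^2+g(y)\}$. Incremental Proximal Method (IPM): given $x_0\in\mathbb{R}^d$, number of epochs $K$, and step sizes $\eta_k>0$; for $k=1,\dots,K$ set $x_{k-1,1}=x_{k-1}$, then for $t=1,\dots,T$ set $x_{k-1,t+1}=\mathrm{prox}_{\eta_k f_t}(x_{k-1,t})$, and set $x_k=x_{k-1,T+1}$. The output is $x_K$; each epoch uses $T$ individual proximal oracle queries. Convention for the complexity claim: $\widetilde{\mathcal O}(X)$ means at most $C\,X\,(\log(\mathrm{e}+X))^p$ for absolute constants $C,p>0$, and the claim is that there exist an integer $K$ and a step size $\eta$ (with $\eta_k=\eta$ for all $k$, allowed to depend on $K$ and the problem parameters) for which $f(x_K)-f(x_* )\le\epsilon$ and $TK=\widetilde{\mathcal O}(X)$; as usual the bound is read in the regime $X\ge T$ (at least one epoch). *)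

(* Defs.v *)
From HB Require Import structures.
From mathcomp Require Import all_boot all_order all_algebra.
From mathcomp Require Import all_classical all_reals all_analysis.

Set Implicit Arguments.
Unset Strict Implicit.
Unset Printing Implicit Defensive.

Import Order.TTheory GRing.Theory Num.Theory.
Local Open Scope classical_set_scope.
Local Open Scope ring_scope.

(* The library norm `|x| on 'rV[R]_d is the sup norm, and the library's
   Lipschitz predicates refer to it; hence the Euclidean versions below. *)
Definition enorm (R : realType) (d : nat) (x : 'rV[R]_d) : R :=
  Num.sqrt (\sum_(i < d) x 0 i ^+ 2).

Definition elipschitz (R : realType) (d : nat) (G : R) (g : 'rV[R]_d -> R) :=
  forall x y, `|g x - g y| <= G * enorm (x - y).

Definition argmin (R : realType) (A : Type) (F : A -> R) : set A :=
  [set y | forall z, F y <= F z].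

(* [xget] selects an element of the argmin set; the default value 0 is only
   taken if that set is empty, which does not happen for g convex and
   Lipschitz and eta > 0, where the minimizer exists and is unique. *)
Definition prox (R : realType) (d : nat) (eta : R) (g : 'rV[R]_d -> R)
    (x : 'rV[R]_d) : 'rV[R]_d :=
  xget 0 (argmin (fun y => (2 * eta)^-1 * enorm (y - x) ^+ 2 + g y)).

Definition avg (R : realType) (d T : nat) (f : 'I_T -> 'rV[R]_d -> R)
    (x : 'rV[R]_d) : R :=
  T%:R^-1 * \sum_(t < T) f t x.

(* [enum 'I_T] lists the indices in increasing order. *)
Definition ipm_epoch (R : realType) (d T : nat) (f : 'I_T -> 'rV[R]_d -> R)
    (eta : R) (x : 'rV[R]_d) : 'rV[R]_d :=
  foldl (fun y t => prox eta (f t) y) x (enum 'I_T).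

(* Epochs are numbered from 1, so [eta 0] is never used. *)
Fixpoint ipm (R : realType) (d T : nat) (f : 'I_T -> 'rV[R]_d -> R)
    (eta : nat -> R) (x0 : 'rV[R]_d) (k : nat) : 'rV[R]_d :=
  if k is k'.+1 then ipm_epoch f (eta k) (ipm f eta x0 k') else x0.

(* Main.v *)
(** Optimality of the proximal point gives
    [2 eta (g p - g z) <= |x - z|^2 - |p - z|^2 - |p - x|^2] for every [z], and,
    taking [z = x], steps of length at most [eta G].  Summing over an epoch from
    [x] to [x'] and moving all function values to [x'] by Lipschitz continuity yields
    [2 eta T (f x' - f z) <= |x - z|^2 - |x' - z|^2 + (eta G T)^2].
    As [z] is free, it can be moved from epoch to epoch along convex combinations
    with the iterates, which makes the estimates telescope to a bound on the last
    iterate.  For a constant step the error sum is a harmonic sum [H_K], and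
    [eta = eps / (G^2 T H_K)] with [K] of order [Y ln (e + Y)],
    [Y = G^2 |x0 - x*|^2 / eps^2], balances both terms. *)

Require Import Defs.
From HB Require Import structures.
From mathcomp Require Import all_boot all_order all_algebra.
From mathcomp Require Import all_classical all_reals all_analysis.
From mathcomp Require Import ring lra.

Set Implicit Arguments.
Unset Strict Implicit.
Unset Printing Implicit Defensive.

Import Order.TTheory GRing.Theory Num.Theory.
Import numFieldNormedType.Exports.
Local Open Scope classical_set_scope.
Local Open Scope ring_scope.

(** * The Euclidean norm: algebra and continuity *)

Lemma enorm_ge0 (R : realType) (d : nat) (x : 'rV[R]_d) : 0 <= enorm x.
Proof. exact: sqrtr_ge0. Qed.

Lemma sqr_enorm (R : realType) (d : nat) (x : 'rV[R]_d) :
  enorm x ^+ 2 = \sum_(i < d) x 0 i ^+ 2.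
Proof. by rewrite sqr_sqrtr // sumr_ge0 // => i _; rewrite sqr_ge0. Qed.

Lemma enorm0 (R : realType) (d : nat) : enorm (0 : 'rV[R]_d) = 0.
Proof.
apply/eqP; rewrite -sqrf_eq0 sqr_enorm big1 // => i _.
by rewrite mxE expr0n.
Qed.

Lemma enormB (R : realType) (d : nat) (x y : 'rV[R]_d) :
  enorm (x - y) = enorm (y - x).
Proof.
rewrite /enorm; congr (Num.sqrt _); apply: eq_bigr => i _.
by rewrite !mxE; ring.
Qed.

Lemma sqr_enormZ (R : realType) (d : nat) (a : R) (x : 'rV[R]_d) :
  enorm (a *: x) ^+ 2 = a ^+ 2 * enorm x ^+ 2.
Proof.
by rewrite !sqr_enorm mulr_sumr; apply: eq_bigr => i _; rewrite mxE exprMn.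
Qed.

Lemma coord_le_enorm (R : realType) (d : nat) (x : 'rV[R]_d) (i : 'I_d) :
  `|x 0 i| <= enorm x.
Proof.
rewrite -(ler_pXn2r (ltn0Sn 1)) ?nnegrE ?normr_ge0 ?enorm_ge0 //.
rewrite sqr_enorm real_normK ?num_real // (bigD1 i) //= lerDl.
by apply: sumr_ge0 => j _; rewrite sqr_ge0.
Qed.

(** Written as a polynomial in [s] because moving from [p] towards [z] has first-order coefficient
    equal to the right-hand side of the three-point inequality. *)
Lemma sqr_enorm_segment (R : realType) (d : nat) (s : R) (p x z : 'rV[R]_d) :
  enorm (s *: z + (1 - s) *: p - x) ^+ 2 =
  enorm (p - x) ^+ 2
  + s * (enorm (x - z) ^+ 2 - enorm (p - z) ^+ 2 - enorm (p - x) ^+ 2)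
  + s ^+ 2 * enorm (p - z) ^+ 2.
Proof.
rewrite !sqr_enorm -!sumrB !mulr_sumr -!big_split /=.
by apply: eq_bigr => i _; rewrite !mxE; ring.
Qed.

Lemma enormB_continuous (R : realType) (d : nat) (x : 'rV[R]_d) :
  continuous (fun y : 'rV[R]_d => enorm (y - x)).
Proof.
move=> y; apply: (@continuous_comp 'rV[R]_d R R
  (fun y : 'rV[R]_d => \sum_(i < d) (y - x) 0 i ^+ 2) Num.sqrt).
  apply: continuous_big => [|i _ z]; first exact: add_continuous.
  apply: (@continuous_comp 'rV[R]_d R R
    (fun v : 'rV[R]_d => (v - x) 0 i) (fun u => u ^+ 2)); last first.
    exact: exprn_continuous.
  rewrite /prop_for /continuous_at; under eq_cvg do rewrite !mxE.
  rewrite !mxE; have ? := @nbhs_filter 'rV[R]_d z; apply: cvgB; last exact: cvg_cst.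
  exact: coord_continuous.
exact: sqrt_continuous.
Qed.

Lemma elipschitz_continuous (R : realType) (d : nat) (G : R)
    (g : 'rV[R]_d -> R) : elipschitz G g -> continuous g.
Proof.
move=> gL x; have ? := @nbhs_filter 'rV[R]_d x.
apply/subr_cvg0.
have enorm_cvg0 : G * enorm (y - x) @[y --> x] --> (0 : R).
  rewrite -(mulr0 G) -(enorm0 R d) -(subrr x).
  apply: cvgM; first exact: cvg_cst.
  exact: enormB_continuous.
apply/norm_cvg0P; apply: (squeeze_cvgr _ (@cvg_cst _ (0 : R) _ _ _) enorm_cvg0).
by near=> y; rewrite normr_ge0 gL.
Unshelve. all: by end_near.
Qed.

(** * A single proximal step *)

Lemma convex_functionP (R : realType) (d : nat) (g : 'rV[R]_d -> R) (s : R)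
    (x y : 'rV[R]_d) :
  convex_function [set: 'rV[R]_d] g -> 0 <= s <= 1 ->
  g (s *: x + (1 - s) *: y) <= s * g x + (1 - s) * g y.
Proof.
move=> gC /andP[s0 s1].
exact: (gC (Itv01 s0 s1) x y (in_setT _) (in_setT _)).
Qed.

(** Far from [x] the quadratic term outweighs any decrease of [g], so a minimizer over a compact box
    is global and the default of [xget] is never taken. *)
Lemma prox_argmin (R : realType) (d : nat) (eta G : R) (g : 'rV[R]_d -> R)
    (x : 'rV[R]_d) :
  0 < eta -> 0 < G -> elipschitz G g ->
  argmin (fun y => (2 * eta)^-1 * enorm (y - x) ^+ 2 + g y) (prox eta g x).
Proof.
move=> eta0 G0 gL; rewrite /prox; apply: xgetPex.
pose phi (y : 'rV[R]_d) := (2 * eta)^-1 * enorm (y - x) ^+ 2 + g y.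
have phi_cont : continuous phi.
  move=> y; have ? := @nbhs_filter 'rV[R]_d y.
  apply: cvgD; last exact: elipschitz_continuous gL _.
  apply: cvgM; first exact: cvg_cst.
  apply: (@continuous_comp 'rV[R]_d R R
    (fun z => enorm (z - x)) (fun u => u ^+ 2)).
    exact: enormB_continuous.
  exact: exprn_continuous.
(* At distance [r] the penalty [r ^+ 2 / (2 * eta)] equals [G * r], the largest possible decrease of
   [g]. A point outside the box has a coordinate off by more than [r], hence a Euclidean distance
   above [r]. *)
pose r := 2 * eta * G.
have r0 : 0 < r by rewrite !mulr_gt0.
pose A := [set v : 'rV[R]_d | forall i, `[x 0 i - r, x 0 i + r]%classic (v 0 i)].
have Ax : A x by move=> i /=; rewrite in_itv /=; lra.
have Acpt : compact A.
  apply: (@rV_compact R d (fun i => `[x 0 i - r, x 0 i + r]%classic)) => i.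
  exact: segment_compact.
have [|p _ pmin] := EVT_min_rV (ex_intro _ x Ax) Acpt (f := phi).
  exact: continuous_subspaceT.
exists p => y.
have [yA|yNA] := pselect (A y); first by apply: pmin; rewrite inE.
apply: (le_trans (pmin x _)); first by rewrite inE.
have [i /negP] : exists i, ~ `[x 0 i - r, x 0 i + r]%classic (y 0 i).
  exact/existsNP.
rewrite /= in_itv /= => yi.
have yx : r < enorm (y - x).
  apply: lt_le_trans (coord_le_enorm (y - x) i); rewrite !mxE ltNge ler_norml.
  by apply: contra yi; lra.
rewrite /phi subrr enorm0 expr0n /= mulr0 add0r.
have := gL x y; rewrite enormB => /ler_normlW gxy.
suff : G * enorm (y - x) <= (2 * eta)^-1 * enorm (y - x) ^+ 2 by lra.
rewrite expr2 mulrA ler_pM2r ?(lt_trans r0) //.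
by rewrite ler_pdivlMl ?mulr_gt0 // ltW.
Qed.

(** Compare [p] with [s *: z + (1 - s) *: p], use convexity, divide by [s] and let [s] tend to 0.
    The limit is replaced by a tolerance [e] and one explicit [s]. *)
Lemma prox_three_point (R : realType) (d : nat) (eta G : R)
    (g : 'rV[R]_d -> R) (x z : 'rV[R]_d) :
  0 < eta -> 0 < G -> convex_function [set: 'rV[R]_d] g -> elipschitz G g ->
  eta * (g (prox eta g x) - g z) <=
  (enorm (x - z) ^+ 2 - enorm (prox eta g x - z) ^+ 2
   - enorm (prox eta g x - x) ^+ 2) / 2.
Proof.
move=> eta0 G0 gC gL; have := prox_argmin x eta0 G0 gL.
set p := prox eta g x => pmin.
apply/ler_addgt0Pr => e e0.
set b := enorm (p - z) ^+ 2.
have b0 : 0 <= b by rewrite sqr_ge0.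
(* Chosen so that the second-order remainder [s * b] is at most [e]; the [+ 1] covers [b = 0]. *)
pose s := Num.min 1 (e / (b + 1)).
have s0 : 0 < s by rewrite lt_min ltr01 divr_gt0 //; lra.
have s1 : s <= 1 by rewrite ge_min lexx.
have sb : s * b <= e.
  have : s * (b + 1) <= e.
    by rewrite -ler_pdivlMr; [rewrite ge_min lexx orbT | lra].
  lra.
have := pmin (s *: z + (1 - s) *: p).
rewrite sqr_enorm_segment -/b.
have := convex_functionP (s := s) z p gC; rewrite (ltW s0) s1 => /(_ isT).
set gs := g (_ + _); set a := enorm (p - x) ^+ 2; set c := enorm (x - z) ^+ 2.
move=> gs_le min_le.
have : s * (g p - g z) <= (2 * eta)^-1 * (s * (c - b - a) + s ^+ 2 * b).
  by lra.
rewrite ler_pdivlMl ?mulr_gt0 // => H.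
have {}H : 2 * eta * (g p - g z) <= (c - b - a) + s * b.
  rewrite -(ler_pM2l s0).
  suff -> : s * (c - b - a + s * b) = s * (c - b - a) + s ^+ 2 * b by lra.
  by ring.
lra.
Qed.

Lemma prox_dist (R : realType) (d : nat) (eta G : R) (g : 'rV[R]_d -> R)
    (x : 'rV[R]_d) :
  0 < eta -> 0 < G -> convex_function [set: 'rV[R]_d] g -> elipschitz G g ->
  enorm (prox eta g x - x) <= eta * G.
Proof.
move=> eta0 G0 gC gL; have := prox_three_point x x eta0 G0 gC gL.
rewrite subrr enorm0 expr0n /=; set p := prox eta g x.
have := gL p x => /ler_normlP [+ _]; rewrite opprB.
have := enorm_ge0 (p - x); rewrite le_eqVlt => /predU1P[<- _ _|e0 gxp H].
  by rewrite mulr_ge0 // ltW.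
rewrite -(ler_pM2r e0) -expr2.
have : eta * (g x - g p) <= eta * (G * enorm (p - x)) by rewrite ler_pM2l.
lra.
Qed.

(** * One epoch of proximal steps *)

Section Epoch.
Context (R : realType) (d T : nat) (G eta : R) (f : 'I_T -> 'rV[R]_d -> R).
Hypotheses (eta0 : 0 < eta) (G0 : 0 < G).
Hypothesis fC : forall t, convex_function [set: 'rV[R]_d] (f t).
Hypothesis fL : forall t, elipschitz G (f t).

Let sweep := foldl (fun y t => prox eta (f t) y).

(** Each step has length at most [eta * G], so it raises any [G]-Lipschitz [g] by at most
    [eta * G ^+ 2]. *)
Lemma prox_sweep_drift (g : 'rV[R]_d -> R) (x : 'rV[R]_d) (s : seq 'I_T) :
  elipschitz G g -> g (sweep x s) - g x <= (size s)%:R * (eta * G ^+ 2).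
Proof.
move=> gL; elim: s x => [|t s IHs] x /=; first by rewrite subrr mul0r.
have := IHs (prox eta (f t) x).
have := gL (prox eta (f t) x) x => /ler_normlW.
have : G * enorm (prox eta (f t) x - x) <= G * (eta * G).
  by rewrite ler_pM2l // prox_dist.
rewrite -natr1; lra.
Qed.

(** With [n] steps left, evaluating the first component at the end of the sweep instead of after its
    own step costs at most [n * (eta * G) ^+ 2]. This fits in the growth of the error term, since
    [2 * n <= (n + 1) ^+ 2 - n ^+ 2]. *)
Lemma prox_sweep_three_point (x z : 'rV[R]_d) (s : seq 'I_T) :
  eta * \sum_(t <- s) (f t (sweep x s) - f t z) <=
  (enorm (x - z) ^+ 2 - enorm (sweep x s - z) ^+ 2
   + (eta * G * (size s)%:R) ^+ 2) / 2.
Proof.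
elim: s x => [|t s IHs] x /=; first by
  rewrite big_nil subrr !mulr0 expr0n addr0 mul0r.
rewrite big_cons -natr1; set x' := prox eta (f t) x.
have := IHs x'.
have := prox_three_point x z eta0 G0 (fC t) (fL t); rewrite -/x'.
have := sqr_ge0 (enorm (x' - x)).
have : eta * (f t (sweep x' s) - f t x') <= eta * ((size s)%:R * (eta * G ^+ 2)).
  by rewrite ler_pM2l // prox_sweep_drift.
have := sqr_ge0 (eta * G).
lra.
Qed.

Lemma ipm_epoch_three_point (x z : 'rV[R]_d) :
  (0 < T)%N ->
  eta * T%:R * (avg f (ipm_epoch f eta x) - avg f z) <=
  (enorm (x - z) ^+ 2 - enorm (ipm_epoch f eta x - z) ^+ 2
   + (eta * G * T%:R) ^+ 2) / 2.
Proof.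
move=> T0; have := prox_sweep_three_point x z (enum 'I_T).
rewrite size_enum_ord big_enum /= sumrB /avg -mulrBr mulrA mulfK //.
by rewrite pnatr_eq0 -lt0n.
Qed.

End Epoch.

(** * From epochs to the last iterate *)

Lemma avg_convex (R : realType) (d T : nat) (f : 'I_T -> 'rV[R]_d -> R) :
  (forall t, convex_function [set: 'rV[R]_d] (f t)) ->
  convex_function [set: 'rV[R]_d] (avg f).
Proof.
move=> fC s x y _ _; rewrite convRE /avg !mulr_sumr -big_split /=.
apply: ler_sum => t _.
rewrite [X in _ <= X + _]mulrCA [X in _ <= _ + X]mulrCA -mulrDr.
by rewrite ler_wpM2l ?invr_ge0 ?ler0n //; exact: fC (in_setT _) (in_setT _).
Qed.

(** [ipm] unfolds at its last epoch, while the induction below removes the first one, which shifts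
    the step sizes. *)
Lemma ipm_recl (R : realType) (d T : nat) (f : 'I_T -> 'rV[R]_d -> R)
    (eta : nat -> R) (x : 'rV[R]_d) (k : nat) :
  ipm f eta x k.+1 = ipm f (fun j => eta j.+1) (ipm_epoch f (eta 1%N) x) k.
Proof. by elim: k => //= k ->. Qed.

(* The comparison point z is arbitrary because the induction removes the first
   epoch x -> x' and applies the bound for the remaining ones to the convex
   combination z' = (eta_1 / S) x' + (S' / S) z, where S' = S - eta_1 is the sum
   of the remaining step sizes. *)
Lemma ipm_last_iterate (R : realType) (d T : nat) (G : R)
    (f : 'I_T -> 'rV[R]_d -> R) (x z : 'rV[R]_d) (K : nat) (eta : nat -> R) :
  (0 < T)%N -> 0 < G ->
  (forall t, convex_function [set: 'rV[R]_d] (f t)) ->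
  (forall t, elipschitz G (f t)) ->
  (0 < K)%N -> (forall k, (1 <= k <= K)%N -> 0 < eta k) ->
  avg f (ipm f eta x K) - avg f z <=
    (2 * T%:R * \sum_(1 <= k < K.+1) eta k)^-1 * enorm (x - z) ^+ 2 +
    G ^+ 2 * T%:R / 2 *
      \sum_(1 <= k < K.+1) (eta k ^+ 2 / \sum_(k <= j < K.+1) eta j).
Proof.
move=> T0 G0 fC fL; case: K => // K _.
have T0' : 0 < T%:R :> R by rewrite ltr0n.
elim: K x z eta => [|K IHK] x z eta eta0.
  have e0 : 0 < eta 1%N by exact: eta0.
  rewrite !big_nat1 /=.
  have := ipm_epoch_three_point e0 G0 fC fL x z T0.
  rewrite -ler_pdivlMl ?mulr_gt0 // => /le_trans; apply.
  have := sqr_ge0 (enorm (ipm_epoch f (eta 1%N) x - z)).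
  set D := enorm (x - z) ^+ 2; set D1 := enorm _ ^+ 2 => D10.
  rewrite -subr_ge0.
  suff -> : (2 * T%:R * eta 1%N)^-1 * D +
      G ^+ 2 * T%:R / 2 * (eta 1%N ^+ 2 / eta 1%N) -
      (eta 1%N * T%:R)^-1 * ((D - D1 + (eta 1%N * G * T%:R) ^+ 2) / 2)
    = (eta 1%N * T%:R)^-1 * D1 / 2.
    by rewrite mulr_ge0 // mulr_ge0 // invr_ge0 mulr_ge0 ?ltW.
  by field; rewrite !lt0r_neq0.
rewrite ipm_recl; set e := eta 1%N; set x' := ipm_epoch f e x.
have sumE : \sum_(1 <= k < K.+3) eta k = e + \sum_(1 <= k < K.+2) eta k.+1.
  by rewrite big_ltn // big_add1.
rewrite [X in _ + _ * X]big_ltn // [X in _ + _ * (_ + X)]big_add1 sumE /=.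
under [X in _ + _ * (_ + X)]eq_bigr => k _ do rewrite big_add1 /=.
have eta'0 k : (1 <= k <= K.+1)%N -> 0 < eta k.+1.
  by case/andP=> k1 kK; apply: eta0.
have e0 : 0 < e by exact: eta0.
set S' := \sum_(1 <= i < K.+2) eta i.+1; set W := \sum_(1 <= i < K.+2) _.
have S'0 : 0 < S'.
  rewrite /S' big_nat_recl // ltr_pwDl ?eta'0 // big_nat; apply: sumr_ge0 => i.
  by case/andP=> _ iK; rewrite ltW // eta'0.
have S0 : 0 < e + S' by rewrite addr_gt0.
pose s := e / (e + S').
have s01 : 0 <= s <= 1.
  apply/andP; split; first by rewrite divr_ge0 ?ltW.
  by rewrite ler_pdivrMr // mul1r lerDl ltW.
have := IHK x' (s *: x' + (1 - s) *: z) _ eta'0; rewrite -/S' -/W.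
have -> : x' - (s *: x' + (1 - s) *: z) = (1 - s) *: (x' - z).
  by apply/rowP => i; rewrite !mxE; ring.
rewrite sqr_enormZ.
have := convex_functionP x' z (avg_convex fC) s01.
have := ipm_epoch_three_point e0 G0 fC fL x z T0; rewrite -/x'.
have := sqr_ge0 (enorm (x' - z)).
set D := enorm (x - z) ^+ 2; set D1 := enorm _ ^+ 2.
set F := avg f (ipm _ _ _ _); set f' := avg f x'; set fz := avg f z.
set fz' := avg f _ => D10 epoch cvx IH.
(* The epoch estimate divided by [T%:R * (e + S')]. By convexity the left side bounds [fz' - fz]. *)
have step : s * (f' - fz) <=
    (2 * T%:R * (e + S'))^-1 * (D - D1) + G ^+ 2 * T%:R / 2 * (e ^+ 2 / (e + S')).
  have TS0 : 0 <= (T%:R * (e + S'))^-1 by rewrite invr_ge0 mulr_ge0 // ltW.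
  have := ler_wpM2l TS0 epoch.
  rewrite (_ : _ * (e * T%:R * (f' - fz)) = s * (f' - fz)).
    move=> /le_trans; apply; rewrite le_eqVlt; apply/orP; left; apply/eqP.
    by field; rewrite !lt0r_neq0.
  by rewrite /s; field; rewrite !lt0r_neq0.
(* Since [1 - s = S' / (e + S')], one factor [1 - s] turns [S'] into [e + S'] and the other is at
   most 1. The result cancels against the [- D1] of [step]. *)
have dist : (2 * T%:R * S')^-1 * ((1 - s) ^+ 2 * D1) <=
    (2 * T%:R * (e + S'))^-1 * D1.
  have -> : (2 * T%:R * S')^-1 * ((1 - s) ^+ 2 * D1) =
      (1 - s) * ((2 * T%:R * (e + S'))^-1 * D1).
    by rewrite /s; field; rewrite !lt0r_neq0.
  apply: ler_piMl; last by lra.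
  by rewrite mulr_ge0 // invr_ge0 !mulr_ge0 // ltW.
rewrite -/e; move: step dist IH.
set c := (2 * T%:R * (e + S'))^-1; set q := e ^+ 2 / (e + S').
by set a := (2 * T%:R * S')^-1 * _; lra.
Qed.

(** * Constant step size and number of epochs *)

Lemma harmonic_sum_le_ln (R : realType) (n : nat) :
  \sum_(1 <= k < n.+2) k%:R^-1 <= 1 + ln n.+1%:R :> R.
Proof.
elim: n => [|n IHn]; first by rewrite big_nat1 ln1 addr0 invr1.
rewrite big_nat_recr //=.
have n0 : 0 < n.+2%:R :> R by rewrite ltr0n.
have n1 : 0 < n.+1%:R :> R by rewrite ltr0n.
(* [ln (1 + u) <= u] at [u = - n.+2%:R^-1] bounds the new term by [ln n.+2%:R - ln n.+1%:R]. *)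
have : ln (1 + - n.+2%:R^-1) <= - n.+2%:R^-1 :> R.
  by apply: le_ln1Dx; rewrite ltrN2 invf_lt1 // ltr1n.
have -> : 1 + - n.+2%:R^-1 = n.+1%:R / n.+2%:R :> R.
  by rewrite -[in RHS](addrK 1 n.+1%:R) natr1 mulrBl divff ?lt0r_neq0 // mul1r.
rewrite ln_div ?posrE //; move: IHn; set h := \sum_(1 <= k < _) _.
by move: (ln n.+1%:R) (ln n.+2%:R) n.+2%:R^-1 => a b c; lra.
Qed.

Lemma sum_const_step (R : realType) (eta : R) (K : nat) :
  eta != 0 ->
  \sum_(1 <= k < K.+1) (eta ^+ 2 / \sum_(k <= j < K.+1) eta) =
  eta * \sum_(1 <= k < K.+1) k%:R^-1.
Proof.
(* After reversal, the tail sum belonging to index [k] consists of exactly [k] copies of [eta]. *)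
move=> eta0; rewrite big_nat_rev mulr_sumr /=; apply: eq_big_nat => k /andP[k1 kK].
rewrite add1n subSS sumr_const_nat subKn ?(ltnW kK) //.
have k0 : k%:R != 0 :> R by rewrite pnatr_eq0 -lt0n.
by rewrite -mulr_natl; field; apply/andP.
Qed.

(** The requirement is implicit, as the epoch count also occurs in the logarithm. A count [k]
    between [7 * (Y * L)] and [8 * (Y * L)] is polynomial in [M]: from [8 <= M ^+ 3] and
    [Y * L <= M ^+ 2] comes [ln k <= 5 * L], hence [1 + ln k <= 7 * L]. *)
Lemma epoch_count (R : realType) (Y : R) :
  1 <= Y -> exists K : nat,
    Y * (1 + ln K.+1%:R) <= K.+1%:R /\ K.+1%:R <= 8 * Y * ln (expR 1 + Y).
Proof.
move=> Y1; set M := expR 1 + Y; set L := ln M.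
have e2 : 2 <= expR 1 :> R by have := expR_ge1Dx (1 : R); lra.
have L1 : 1 <= L by rewrite -(expRK 1) ler_ln ?posrE ?expR_gt0 // /M; lra.
have LM : L <= M.
  have : ln (1 + (M - 1)) <= M - 1 by apply: le_ln1Dx; rewrite /M; lra.
  by rewrite addrC subrK -/L; lra.
have YL1 : 1 <= Y * L by rewrite -(mulr1 1) ler_pM.
have YL0 : 0 <= 7 * (Y * L) by lra.
exists (Num.trunc (7 * (Y * L))).
have /andP[] := truncn_itv YL0; set K := Num.trunc _; set k := K.+1%:R => Kle ltk.
have k8 : k <= 8 * (Y * L) by rewrite /k -natr1; lra.
have kM : k <= M ^+ 5.
  apply: le_trans k8 _; rewrite (exprD M 3 2).
  apply: ler_pM => //; first lra.
    rewrite (_ : 8 = 2 ^+ 3); last by ring.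
    by rewrite lerXn2r ?nnegrE /M //; lra.
  by rewrite expr2 ler_pM //; rewrite /M; lra.
split; last by rewrite -mulrA.
have lnk : ln k <= 5 * L.
  rewrite mulr_natl -lnXn; last by rewrite /M; lra.
  by rewrite ler_ln ?posrE ?exprn_gt0 ?ltr0n // /M; lra.
apply: le_trans (ltW ltk); rewrite mulrCA ler_pM2l; lra.
Qed.

Theorem theorem3p3 (R : realType) :
  (forall (d T : nat) (G : R) (f : 'I_T -> 'rV[R]_d -> R)
          (x0 xs : 'rV[R]_d) (K : nat) (eta : nat -> R),
    (1 <= T)%N ->
    0 < G ->
    (forall t : 'I_T, convex_function [set: 'rV[R]_d] (f t)) ->
    (forall t : 'I_T, elipschitz G (f t)) ->
    argmin (avg f) xs ->
    (1 <= K)%N ->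
    (forall k : nat, (1 <= k <= K)%N -> 0 < eta k) ->
    avg f (ipm f eta x0 K) - avg f xs <=
      (2 * T%:R * \sum_(1 <= k < K.+1) eta k)^-1 * enorm (x0 - xs) ^+ 2 +
      G ^+ 2 * T%:R / 2 *
        \sum_(1 <= k < K.+1) (eta k ^+ 2 / \sum_(k <= j < K.+1) eta j))
  /\
  (exists C p : R, 0 < C /\ 0 < p /\
    forall (d T : nat) (G : R) (f : 'I_T -> 'rV[R]_d -> R)
           (x0 xs : 'rV[R]_d) (eps : R),
      (1 <= T)%N ->
      0 < G ->
      (forall t : 'I_T, convex_function [set: 'rV[R]_d] (f t)) ->
      (forall t : 'I_T, elipschitz G (f t)) ->
      argmin (avg f) xs ->
      0 < eps ->
      let X := G ^+ 2 * T%:R * enorm (x0 - xs) ^+ 2 / eps ^+ 2 in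
      T%:R <= X ->
      exists (K : nat) (eta : R),
        (1 <= K)%N /\ 0 < eta /\
        avg f (ipm f (fun=> eta) x0 K) - avg f xs <= eps /\
        (T * K)%:R <= C * X * ln (expR 1 + X) `^ p).
Proof.
split=> [d T G f x0 xs K eta T0 G0 fC fL _ K0 eta0|].
  exact: ipm_last_iterate.
exists 8, 1; split=> //; split=> // d T G f x0 xs eps T0 G0 fC fL _ eps0 X TX.
have T0' : 0 < T%:R :> R by rewrite ltr0n.
set D := enorm (x0 - xs) ^+ 2 in X TX *.
pose Y := G ^+ 2 * D / eps ^+ 2.
have XE : X = T%:R * Y by rewrite /X /Y; ring.
(* [Y] is [X] per component; the regime of at least one epoch, [T%:R <= X], says exactly that
   [1 <= Y]. *)
have Y1 : 1 <= Y by rewrite -(ler_pM2l T0') mulr1 -XE.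
have [K [Kge Kle]] := epoch_count Y1.
pose H : R := \sum_(1 <= k < K.+2) k%:R^-1.
have H0 : 0 < H.
  rewrite /H big_ltn // ltr_pwDl ?invr_gt0 ?ltr0n //.
  by apply: sumr_ge0 => i _; rewrite invr_ge0.
have G20 : 0 < G ^+ 2 by rewrite exprn_gt0.
(* This value makes the error term equal to [eps / 2]. The distance term becomes
   [eps / 2 * (Y * H / K.+1%:R)], where the quotient is at most 1 because [H <= 1 + ln K.+1%:R]. *)
pose eta := eps / (G ^+ 2 * T%:R * H).
have eta0 : 0 < eta by rewrite divr_gt0 // !mulr_gt0.
exists K.+1, eta; do 2![split=> //]; split.
  apply: le_trans (ipm_last_iterate x0 xs T0 G0 fC fL (ltn0Sn K) (fun _ _ => eta0)) _.
  rewrite sum_const_step ?lt0r_neq0 // sumr_const_nat subSS subn0 -/H -/D.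
  have K0 : 0 < K.+1%:R :> R by rewrite ltr0n.
  rewrite -(mulr_natl eta).
  have -> : G ^+ 2 * T%:R / 2 * (eta * H) = eps / 2.
    by rewrite /eta; field; rewrite !lt0r_neq0.
  have -> : (2 * T%:R * (K.+1%:R * eta))^-1 * D = eps / 2 * (Y * H / K.+1%:R).
    by rewrite /eta /Y; field; rewrite !lt0r_neq0.
  suff : Y * H / K.+1%:R <= 1.
    move: (Y * H / _) => q q1; have : eps * q <= eps * 1 by rewrite ler_pM2l.
    by lra.
  rewrite ler_pdivrMr // mul1r; apply: le_trans Kge.
  by rewrite ler_pM2l ?harmonic_sum_le_ln //; lra.
rewrite powRr1; last by rewrite ln_ge0 //; have := expR_ge1Dx (1 : R); nra.
(* The factor [T] is absorbed in [X = T%:R * Y]; inside the logarithm [Y <= X] suffices. *)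
rewrite natrM XE [8 * _]mulrCA -mulrA ler_pM2l //; apply: le_trans Kle _.
rewrite ler_pM2l; last lra.
have T1 : 1 <= T%:R :> R by rewrite ler1n.
have eY : 0 < expR 1 + Y by rewrite addr_gt0 ?expR_gt0 //; lra.
have YTY : Y <= T%:R * Y by rewrite ler_peMl //; lra.
by rewrite ler_ln ?posrE ?lerD2l //; lra.
Qed.
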